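(* Let $\hat H(s,p)$ be the parametric transfer function $$\hat H(s,p)=\hat C(p)(sI_n-\hat A(p))^{-1}\hat B(p)+\hat D(p),$$ $$\hat A(p)=\mathcal{Y}\mathcal{K}(p)^{-1}\mathcal{X},\quad \hat B(p)=\mathcal{Y}\mathcal{K}(p)^{-1}\mathcal{B},\quad \hat C(p)=\mathcal{C}\mathcal{K}(p)^{-1}\mathcal{X},\quad \hat D(p)=\mathcal{C}\mathcal{K}(p)^{-1}\mathcal{B},$$ constructed by the Loewner framework from snapshot data as described in the context. If $\mathcal{K}(p)$ and $\mathcal{K}(p)-s^{-1}\mathcal{X}\mathcal{Y}$ are invertible (the latter being understood to require that $s^{-1}$ is defined), then $s\neq 0$ and $$\hat H(s,p)=\mathcal{C}\left(p\mathcal{E}-s^{-1}\mathcal{X}\mathcal{Y}-\mathcal{A}\right)^{-1}\mathcal{B},$$ where $$\mathcal{E}=-X_r^T\mathbb{L}Y_r\in\mathbb{R}^{r\times r},\qquad \mathcal{A}=-X_r^T\mathbb{L}_sY_r\in\mathbb{R}^{r\times r},\qquad \mathcal{X}\mathcal{Y}=X_r^T\mathbb{T}Y_r\in\mathbb{R}^{r\times r},$$ and $\mathbb{T}\in\mathbb{R}^{M(n+n_{\mathrm o})\times N(n+n_{\mathrm i})}$ is the block matrix with $(i,j)$-th block $$\{\mathbb{T}\}_{i,j}=\begin{bmatrix}A(\pi_i)A(\phi_j)&A(\pi_i)B(\phi_j)\\ C(\pi_i)A(\phi_j)&C(\pi_i)B(\phi_j)\end{bmatrix}.$$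
   Context: Setting. $A(p)\in\mathbb{R}^{n\times n}$, $B(p)\in\mathbb{R}^{n\times n_{\mathrm i}}$, $C(p)\in\mathbb{R}^{n_{\mathrm o}\times n}$, $D(p)\in\mathbb{R}^{n_{\mathrm o}\times n_{\mathrm i}}$ are the matrices of a parametric linear system, $p\in P\subset\mathbb{R}$, and $s\in\mathbb{C}$ is the frequency variable. For a set of parameter samples $\Pi=\{p_1,\dots,p_{n_p}\}\subset P$ the snapshot matrices are $$G(p_i)=\begin{bmatrix}A(p_i)&B(p_i)\\C(p_i)&D(p_i)\end{bmatrix}\in\mathbb{R}^{(n+n_{\mathrm o})\times(n+n_{\mathrm i})}.$$ Loewner framework for matrix data. The sample set is partitioned into two disjoint sets, $\Pi=\{\pi_1,\dots,\pi_M\}\cup\{\phi_1,\dots,\phi_N\}\subset\mathbb{R}$ with $M+N=n_p$, $M,N\ge 1$ (samples are pairwise distinct). Set $$\mathcal{V}=\begin{bmatrix}G(\pi_1)\\ \vdots\\ G(\pi_M)\end{bmatrix},\qquad \mathcal{W}=\begin{bmatrix}G(\phi_1)&\cdots&G(\phi_N)\end{bmatrix}.$$ The Loewner matrix $\mathbb{L}$ and shifted Loewner matrix $\mathbb{L}_s$, both in $\mathbb{R}^{M(n+n_{\mathrm o})\times N(n+n_{\mathrm i})}$, are the block matrices whose $(i,j)$-th blocks, of size $(n+n_{\mathrm o})\times(n+n_{\mathrm i})$, are $$\{\mathbb{L}\}_{i,j}=\frac{G(\pi_i)-G(\phi_j)}{\pi_i-\phi_j},\qquad \{\mathbb{L}_s\}_{i,j}=\frac{\pi_iG(\pi_i)-\phi_jG(\phi_j)}{\pi_i-\phi_j}.$$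 Take singular value decompositions $\begin{bmatrix}\mathbb{L}&\mathbb{L}_s\end{bmatrix}=X\Sigma_1\tilde Y^T$ and $\begin{bmatrix}\mathbb{L}\\ \mathbb{L}_s\end{bmatrix}=\tilde X\Sigma_2Y^T$. For a chosen truncation rank $r$, let $X_r\in\mathbb{R}^{M(n+n_{\mathrm o})\times r}$ and $Y_r\in\mathbb{R}^{N(n+n_{\mathrm i})\times r}$ consist of the first $r$ columns of $X$ and $Y$. Set $$\mathcal{K}(p)=X_r^T(\mathbb{L}_s-p\mathbb{L})Y_r\in\mathbb{R}^{r\times r}.$$ The blocks $\mathcal{Y}\in\mathbb{R}^{n\times r}$, $\mathcal{C}\in\mathbb{R}^{n_{\mathrm o}\times r}$, $\mathcal{X}\in\mathbb{R}^{r\times n}$, $\mathcal{B}\in\mathbb{R}^{r\times n_{\mathrm i}}$ are defined by the conforming splittings $$\mathcal{W}Y_r=\begin{bmatrix}\mathcal{Y}\\ \mathcal{C}\end{bmatrix},\qquad X_r^T\mathcal{V}=\begin{bmatrix}\mathcal{X}&\mathcal{B}\end{bmatrix}.$$ *)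

(* Defs.v *)
From HB Require Import structures.
From mathcomp Require Import all_boot all_order all_algebra.
From mathcomp Require Import complex.
From mathcomp Require Import classical_sets reals.

Set Implicit Arguments.
Unset Strict Implicit.
Unset Printing Implicit Defensive.

Import Order.TTheory GRing.Theory Num.Theory.
Local Open Scope ring_scope.

Record psystem (R : Type) (n ni no : nat) := PSystem {
  sysA : R -> 'M[R]_n;
  sysB : R -> 'M[R]_(n, ni);
  sysC : R -> 'M[R]_(no, n);
  sysD : R -> 'M[R]_(no, ni)
}.

Definition snapshot (R : Type) (n ni no : nat) (sys : psystem R n ni no)
    (p : R) : 'M[R]_(n + no, n + ni) :=
  block_mx (sysA sys p) (sysB sys p) (sysC sys p) (sysD sys p).

Definition loewner (R : fieldType) (k l M N : nat) (G : R -> 'M[R]_(k, l))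
    (pi_ : 'I_M -> R) (phi_ : 'I_N -> R) :
    'M[R]_(\sum_(i < M) k, \sum_(j < N) l) :=
  \mxblock_(i < M, j < N)
    ((pi_ i - phi_ j)^-1 *: (G (pi_ i) - G (phi_ j))).

Definition shifted_loewner (R : fieldType) (k l M N : nat)
    (G : R -> 'M[R]_(k, l)) (pi_ : 'I_M -> R) (phi_ : 'I_N -> R) :
    'M[R]_(\sum_(i < M) k, \sum_(j < N) l) :=
  \mxblock_(i < M, j < N)
    ((pi_ i - phi_ j)^-1 *: (pi_ i *: G (pi_ i) - phi_ j *: G (phi_ j))).

Definition cross_matrix (R : fieldType) (n ni no M N : nat)
    (sys : psystem R n ni no) (pi_ : 'I_M -> R) (phi_ : 'I_N -> R) :
    'M[R]_(\sum_(i < M) (n + no), \sum_(j < N) (n + ni)) :=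
  \mxblock_(i < M, j < N)
    block_mx (sysA sys (pi_ i) *m sysA sys (phi_ j))
             (sysA sys (pi_ i) *m sysB sys (phi_ j))
             (sysC sys (pi_ i) *m sysA sys (phi_ j))
             (sysC sys (pi_ i) *m sysB sys (phi_ j)).

(* Full (square U and V) singular value decomposition A = U Sigma V^T, with
   the singular values in nonincreasing order. *)
Definition is_svd (R : realFieldType) (k l : nat) (A : 'M[R]_(k, l))
    (U : 'M[R]_k) (Sigma : 'M[R]_(k, l)) (V : 'M[R]_l) : Prop :=
  [/\ U^T *m U = 1%:M,
      V^T *m V = 1%:M,
      is_diag_mx Sigma,
      (forall i j, 0 <= Sigma i j) /\
      (forall (i i' : 'I_k) (j j' : 'I_l),
          i = j :> nat -> i' = j' :> nat -> (i <= i')%N ->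
          Sigma i' j' <= Sigma i j)
    & A = U *m Sigma *m V^T].

Definition first_cols (R : Type) (k l r : nat) (le_rl : (r <= l)%N)
    (A : 'M[R]_(k, l)) : 'M[R]_(k, r) :=
  colsub (widen_ord le_rl) A.

Definition cplx (R : rcfType) (k l : nat) (A : 'M[R]_(k, l)) :
    'M[R[i]]_(k, l) :=
  map_mx (real_complex R) A.

(* Meaningful only if s I - A is invertible: invmx is the identity on singular
   matrices. *)
Definition transfer (F : fieldType) (n ni no : nat) (A : 'M[F]_n)
    (B : 'M[F]_(n, ni)) (C : 'M[F]_(no, n)) (D : 'M[F]_(no, ni)) (s : F) :
    'M[F]_(no, ni) :=
  C *m invmx (s%:M - A) *m B + D.

(* Main.v *)
(** Put Z = s^-1 X Y and Q = K - Z. The push-through (Woodbury) identity inverts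
    s I - Y K^-1 X as s^-1 (I + s^-1 Y Q^-1 X); the transfer function then becomes
    C (K^-1 + K^-1 Z K^-1 + K^-1 Z Q^-1 Z K^-1) B, and two applications of the
    resolvent identity collapse the middle factor to Q^-1. Here
    K = Xr^T (Ls - p L) Yr, so Q is the pencil p E - s^-1 X Y - A. *)

Require Import Defs.
From HB Require Import structures.
From mathcomp Require Import all_boot all_order all_algebra.
From mathcomp Require Import complex.
From mathcomp Require Import classical_sets reals.

Set Implicit Arguments.
Unset Strict Implicit.
Unset Printing Implicit Defensive.

Import Order.TTheory GRing.Theory Num.Theory.
Local Open Scope ring_scope.

Section Resolvent.
Variable F : fieldType.

(** Writing [Z] as [K - (K - Z)] makes each of the two terms cancel against one of the inverses. The
    mirrored version below is needed because [Z] commutes with neither inverse. *)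
Lemma resolventl r (K Z : 'M[F]_r) : K \in unitmx -> K - Z \in unitmx ->
  invmx K *m Z *m invmx (K - Z) = invmx (K - Z) - invmx K.
Proof.
move=> Ku Qu; rewrite -{1}[Z](subKr K) mulmxBr mulVmx // mulmxBl mul1mx.
by rewrite -mulmxA mulmxV // mulmx1.
Qed.

Lemma resolventr r (K Z : 'M[F]_r) : K \in unitmx -> K - Z \in unitmx ->
  invmx (K - Z) *m Z *m invmx K = invmx (K - Z) - invmx K.
Proof.
move=> Ku Qu; rewrite -{2}[Z](subKr K) mulmxBr mulVmx // mulmxBl mul1mx.
by rewrite -mulmxA mulmxV // mulmx1.
Qed.

Variables (n r : nat) (K : 'M[F]_r) (X : 'M[F]_(r, n)) (Y : 'M[F]_(n, r)) (s : F).
Hypotheses (s_neq0 : s != 0) (Ku : K \in unitmx).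
Hypothesis (Qu : K - s^-1 *: (X *m Y) \in unitmx).

(** For square matrices an explicit right inverse suffices: it yields both the invertibility of
    [s%:M - Y *m invmx K *m X] and the value of its inverse. *)
Lemma woodbury_mulV : (s%:M - Y *m invmx K *m X) *m
  (s^-1 *: (1%:M + s^-1 *: (Y *m invmx (K - s^-1 *: (X *m Y)) *m X))) = 1%:M.
Proof.
have := resolventl Ku Qu; set Q := invmx (K - _) => resQ.
rewrite -scalemxAr mulmxDr mulmx1 mulmxBl mul_scalar_mx scalerA mulfV // scale1r.
(* The scalar [s^-1] moves inward to meet [X *m Y], exposing the left side of the resolvent
   identity. *)
have -> : Y *m invmx K *m X *m (s^-1 *: (Y *m Q *m X)) =
    Y *m (invmx K *m (s^-1 *: (X *m Y)) *m Q) *m X.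
  by rewrite -!(scalemxAr, scalemxAl) !mulmxA.
by rewrite resQ mulmxBr mulmxBl subKr subrK scale_scalar_mx mulVf.
Qed.

Lemma woodbury_unit : s%:M - Y *m invmx K *m X \in unitmx.
Proof. by have /mulmx1_unit[] := woodbury_mulV. Qed.

Lemma woodbury_invmx : invmx (s%:M - Y *m invmx K *m X) =
  s^-1 *: (1%:M + s^-1 *: (Y *m invmx (K - s^-1 *: (X *m Y)) *m X)).
Proof.
apply: (can_inj (mulKmx woodbury_unit)).
by rewrite mulmxV ?woodbury_unit // woodbury_mulV.
Qed.

Lemma transfer_realization ni no (B : 'M[F]_(r, ni)) (C : 'M[F]_(no, r)) :
  transfer (Y *m invmx K *m X) (Y *m invmx K *m B) (C *m invmx K *m X)
    (C *m invmx K *m B) s = C *m invmx (K - s^-1 *: (X *m Y)) *m B.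
Proof.
rewrite /transfer woodbury_invmx.
have := resolventl Ku Qu; have := resolventr Ku Qu.
set Z := s^-1 *: (X *m Y); set Q := invmx (K - Z) => resr resl.
(* Each factor [s^-1] is absorbed by one product [X *m Y]: one in the first term, two in the
   second. *)
have -> : C *m invmx K *m X *m (s^-1 *: (1%:M + s^-1 *: (Y *m Q *m X)))
    *m (Y *m invmx K *m B) =
    C *m (invmx K *m Z *m invmx K + invmx K *m Z *m Q *m Z *m invmx K) *m B.
  rewrite /Z !(mulmxDr, mulmxDl, scalerDr) -!(scalemxAr, scalemxAl) mulmx1.
  by rewrite !mulmxA.
(* With [K^-1 Z Q = Q - K^-1] and [Q Z K^-1 = Q - K^-1], the middle factor is [K^-1 Z K^-1 + (Q -
   K^-1 - K^-1 Z K^-1) + K^-1], which telescopes to [Q]. *)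
rewrite resl -mulmxDl -mulmxDr; congr (C *m _ *m B).
by rewrite !mulmxBl resr [invmx K *m Z *m _ + _]addrC !subrK.
Qed.

End Resolvent.

Lemma cplxM (R : rcfType) a b c (A : 'M[R]_(a, b)) (B : 'M[R]_(b, c)) :
  cplx (A *m B) = cplx A *m cplx B.
Proof. exact: map_mxM. Qed.

Lemma cplx_mulVmx (R : rcfType) a r c (A : 'M[R]_(a, r)) (K : 'M[R]_r)
    (B : 'M[R]_(r, c)) :
  cplx (A *m invmx K *m B) = cplx A *m invmx (cplx K) *m cplx B.
Proof. by rewrite !cplxM /cplx map_invmx. Qed.

(** The inverse of [K] is taken over the reals, that of the resolvent over [R[i]]. A field embedding
    commutes with inversion and preserves invertibility, so the identity over a general field
    applies to the embedded matrices. *)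
Lemma cplx_transfer_realization (R : rcfType) n ni no r (K : 'M[R]_r)
    (X : 'M[R]_(r, n)) (Y : 'M[R]_(n, r)) (B : 'M[R]_(r, ni))
    (C : 'M[R]_(no, r)) (s : R[i]) :
  s != 0 -> K \in unitmx -> cplx K - s^-1 *: cplx (X *m Y) \in unitmx ->
  s%:M - cplx (Y *m invmx K *m X) \in unitmx /\
  transfer (cplx (Y *m invmx K *m X)) (cplx (Y *m invmx K *m B))
    (cplx (C *m invmx K *m X)) (cplx (C *m invmx K *m B)) s =
  cplx C *m invmx (cplx K - s^-1 *: cplx (X *m Y)) *m cplx B.
Proof.
move=> s_neq0 Ku; have cKu : cplx K \in unitmx by rewrite map_unitmx.
rewrite !cplx_mulVmx cplxM => Qu.
by split; [exact: woodbury_unit | exact: transfer_realization].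
Qed.

Lemma lsubmx_mul (R : pzRingType) k l m1 m2 (A : 'M[R]_(k, l)) (B : 'M[R]_(l, m1 + m2)) :
  lsubmx (A *m B) = A *m lsubmx B.
Proof. by rewrite -{1}[B]hsubmxK mul_mx_row row_mxKl. Qed.

Lemma usubmx_mul (R : pzRingType) k1 k2 l m (A : 'M[R]_(k1 + k2, l)) (B : 'M[R]_(l, m)) :
  usubmx (A *m B) = usubmx A *m B.
Proof. by rewrite -{1}[A]vsubmxK mul_col_mx col_mxKu. Qed.

(** Block [(i, j)] is the outer product of the column [[A; C]] at [pi_ i] with the row [[A B]] at
    [phi_ j], so the whole matrix is a block outer product. *)
Lemma cross_matrixE (F : fieldType) n ni no M N (sys : psystem F n ni no)
    (pi_ : 'I_M -> F) (phi_ : 'I_N -> F) :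
  cross_matrix sys pi_ phi_ =
    lsubmx (\mxcol_(i < M) snapshot sys (pi_ i)) *m
    usubmx (\mxrow_(j < N) snapshot sys (phi_ j)).
Proof.
have -> : lsubmx (\mxcol_(i < M) snapshot sys (pi_ i)) =
    \mxcol_(i < M) lsubmx (snapshot sys (pi_ i)).
  by apply/matrixP => i j; rewrite !mxE.
have -> : usubmx (\mxrow_(j < N) snapshot sys (phi_ j)) =
    \mxrow_(j < N) usubmx (snapshot sys (phi_ j)).
  by apply/matrixP => i j; rewrite !mxE.
rewrite mul_mxcol_mxrow; apply: eq_mxblock => i j.
by rewrite /snapshot [X in lsubmx X]block_mxEh row_mxKl block_mxEv col_mxKu mul_col_row.
Qed.

Theorem theorem3p2 (R : realType) (n ni no M N r : nat)
  (P : set R) (sys : psystem R n ni no)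
  (pi_ : 'I_M -> R) (phi_ : 'I_N -> R)
  (M_ge1 : (1 <= M)%N) (N_ge1 : (1 <= N)%N)
  (pi_P : forall i, P (pi_ i)) (phi_P : forall j, P (phi_ j))
  (pi_inj : injective pi_) (phi_inj : injective phi_)
  (pi_phi_disjoint : forall i j, pi_ i != phi_ j)
  (X : 'M[R]_(\sum_(i < M) (n + no)))
  (Sigma1 : 'M[R]_(\sum_(i < M) (n + no),
                   \sum_(j < N) (n + ni) + \sum_(j < N) (n + ni)))
  (Yt : 'M[R]_(\sum_(j < N) (n + ni) + \sum_(j < N) (n + ni)))
  (Xt : 'M[R]_(\sum_(i < M) (n + no) + \sum_(i < M) (n + no)))
  (Sigma2 : 'M[R]_(\sum_(i < M) (n + no) + \sum_(i < M) (n + no),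
                   \sum_(j < N) (n + ni)))
  (Y : 'M[R]_(\sum_(j < N) (n + ni)))
  (r_leX : (r <= \sum_(i < M) (n + no))%N)
  (r_leY : (r <= \sum_(j < N) (n + ni))%N)
  (p : R) (p_P : P p) (s : R[i]) :
  let G := snapshot sys in
  let L := loewner G pi_ phi_ in
  let Ls := shifted_loewner G pi_ phi_ in
  let T := cross_matrix sys pi_ phi_ in
  let V := \mxcol_(i < M) G (pi_ i) in
  let W := \mxrow_(j < N) G (phi_ j) in
  is_svd (row_mx L Ls) X Sigma1 Yt ->
  is_svd (col_mx L Ls) Xt Sigma2 Y ->
  let Xr := first_cols r_leX X in
  let Yr := first_cols r_leY Y in
  let K (q : R) := Xr^T *m (Ls - q *: L) *m Yr in
  let cY : 'M[R]_(n, r) := usubmx (W *m Yr) in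
  let cC : 'M[R]_(no, r) := dsubmx (W *m Yr) in
  let cX : 'M[R]_(r, n) := lsubmx (Xr^T *m V) in
  let cB : 'M[R]_(r, ni) := rsubmx (Xr^T *m V) in
  let Ahat (q : R) := cY *m invmx (K q) *m cX in
  let Bhat (q : R) := cY *m invmx (K q) *m cB in
  let Chat (q : R) := cC *m invmx (K q) *m cX in
  let Dhat (q : R) := cC *m invmx (K q) *m cB in
  let Hhat (z : R[i]) (q : R) :=
    transfer (cplx (Ahat q)) (cplx (Bhat q)) (cplx (Chat q)) (cplx (Dhat q)) z in
  let cE := - (Xr^T *m L *m Yr) in
  let cA := - (Xr^T *m Ls *m Yr) in
  K p \in unitmx ->
  s \is a GRing.unit ->
  cplx (K p) - s^-1 *: cplx (cX *m cY) \in unitmx ->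
  [/\ s != 0,
      s%:M - cplx (Ahat p) \in unitmx,
      cplx (p *: cE) - s^-1 *: cplx (cX *m cY) - cplx cA \in unitmx,
      Hhat s p = cplx cC
        *m invmx (cplx (p *: cE) - s^-1 *: cplx (cX *m cY) - cplx cA)
        *m cplx cB
    & cX *m cY = Xr^T *m T *m Yr].
Proof.
move=> G L Ls T V W _ _ Xr Yr K cY cC cX cB Ahat Bhat Chat Dhat Hhat cE cA.
move=> Ku su Qu.
(* As [0^-1 = 0] by convention, the unit hypothesis is what says that [s^-1] is defined. *)
have s_neq0 : s != 0 by rewrite -unitfE.
(* The minus signs in [cE] and [cA] give [p *: cE - cA = K p]. *)
have pencilE : cplx (p *: cE) - s^-1 *: cplx (cX *m cY) - cplx cA =
    cplx (K p) - s^-1 *: cplx (cX *m cY).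
  rewrite addrAC -map_mxB; congr (cplx _ - _).
  rewrite /K /cE /cA mulmxBr mulmxBl -scalemxAr -scalemxAl.
  by rewrite scalerN opprK addrC.
have [sAu HhatE] := cplx_transfer_realization cB cC s_neq0 Ku Qu.
rewrite pencilE; split => //.
(* Column slicing passes through the left factor [Xr^T] and row slicing through the right factor
   [Yr], leaving the two factors of [T] in between. *)
by rewrite /cX /cY lsubmx_mul usubmx_mul /T cross_matrixE !mulmxA.
Qed.
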